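(* For any connected finite graph $G$ with $n$ vertices, the chromatic symmetric homology $H^{\mathrm{CS}}(G)$ is supported in bigradings $(i,j)$ which satisfy $0\leq i\leq n-1$ and $0\leq j\leq i$; that is, the component of homological degree $i$ and internal degree $j$ vanishes for all other $(i,j)$.
   Context: A finite graph $G=(V,E)$ consists of a finite set $V$ and a set $E$ of 2-element subsets of $V$. Let $n=|V|$ and fix an ordering $e_1,\dots,e_m$ of $E$. $\mathbb{C}[S_n]\text{-}\mathbf{gmod}$ is the category of graded $\mathbb{C}[S_n]$-modules and degree-preserving homomorphisms. $S^\lambda$ is the irreducible $\mathbb{C}[S_n]$-module indexed by the partition $\lambda\vdash n$. For $n\in\mathbb{N}$, $n\ge1$, let $\mathcal{L}_n$ be the graded $\mathbb{C}[S_n]$-module \[\mathcal{L}_n=\bigwedge\nolimits^{*}S^{(n-1,1)}=\bigoplus_{k=0}^{n-1}\bigwedge\nolimits^{k}S^{(n-1,1)}=\bigoplus_{k=0}^{n-1}S^{(n-k,1^k)}\{k\},\] where $\{k\}$ shifts the grading up by $k$, so the $k$-th exterior power sits in degree $k$ (for $n=1$ this is the trivial module in degree $0$). For $T\subseteq E$, let $B_1,\dots,B_r$ be the vertex sets of the connected components of the spanning subgraph $(V,T)$, $b_i=|B_i|$, and let \[\mathcal{M}_T=\mathrm{Ind}_{S_{B_1}\times\cdots\times S_{B_r}}^{S_{V}}(\mathcal{L}_{b_1}\otimes\cdots\otimes\mathcal{L}_{b_r}),\qquad S_V\cong S_n,\] which depends only on the partition of $V$ into components of $T$. The chromatic symmetric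 functor $F^{\mathrm{CS}}$ is a functor from the Boolean lattice $2^E$ (subsets of $E$ ordered by inclusion, viewed as a category) to $\mathbb{C}[S_n]\text{-}\mathbf{gmod}$ with $F^{\mathrm{CS}}(T)=\mathcal{M}_T$ and $F^{\mathrm{CS}}(T\lessdot T\cup\{e\})=d_{T\lessdot T\cup\{e\}}:\mathcal{M}_T\to\mathcal{M}_{T\cup\{e\}}$ on cover relations, where $d_{T\lessdot T\cup\{e\}}$ is the identity map whenever adding $e$ to $T$ completes a cycle. When $e$ joins two distinct components, $d_{T\lessdot T\cup\{e\}}$ is a prescribed morphism of graded $\mathbb{C}[S_n]$-modules (the one of Sazdanović and Yip); the statement is to be read for any such choice making $F^{\mathrm{CS}}$ a functor. Let $c(T\lessdot T\cup\{e_i\})=(-1)^{\#\{e_j\in T\,:\,j<i\}}$. The chromatic symmetric homology $H^{\mathrm{CS}}(G)$ is the cohomology of the cochain complex with $C^k=\bigoplus_{|T|=k}F^{\mathrm{CS}}(T)$ and differential $\delta^k=\sum_{T\lessdot T',\,|T|=k}c(T\lessdot T')F^{\mathrm{CS}}(T\lessdot T')$. In the bigrading $(i,j)$, $i$ is the cohomological degree $|T|$ and $j$ is the internal degree of the graded $\mathbb{C}[S_n]$-modules. *)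

(* Defs.v *)
From mathcomp Require Import all_boot all_order all_algebra all_fingroup.
From mathcomp Require Import mxrepresentation character.

Set Implicit Arguments.
Unset Strict Implicit.
Unset Printing Implicit Defensive.

Import GroupScope GRing.Theory Num.Theory.
Local Open Scope ring_scope.

(* The product s * t of {perm X} is "s first, then t", and mx_representation *)
(* acts on row vectors from the right.  The two reversals cancel: a matrix   *)
(* representation of {perm X} is a left module over the group algebra of S_X *)
(* with its usual composition of permutations.                               *)

Section ExteriorPower.

Variable K : fieldType.

Definition increasing_tuples (k n : nat) : {set k.-tuple 'I_n} :=
  [set t : k.-tuple 'I_n | sorted ltn (map val t)].

Definition extdim k n := #|increasing_tuples k n|.

(* The exterior product of the k rows of X, in the basis of the k-th exterior *)
(* power of 'rV_n consisting of the products e_(t_0) /\ ... /\ e_(t_(k-1))    *)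
(* for t_0 < ... < t_(k-1).                                                   *)
Definition wedge k n (X : 'M[K]_(k, n)) : 'rV[K]_(extdim k n) :=
  \row_J \det (colsub (tnth (enum_val J)) X).

(* The k-th exterior power of the endomorphism A: it maps the basis vector    *)
(* indexed by I to the exterior product of the rows of A indexed by I.        *)
Definition extpow k n (A : 'M[K]_n) : 'M[K]_(extdim k n) :=
  \matrix_(I < extdim k n) wedge (rowsub (tnth (enum_val I)) A).

Lemma wedge_alternate k n (X : 'M[K]_(k, n)) i1 i2 :
  i1 != i2 -> row i1 X = row i2 X -> wedge X = 0.
Proof.
move=> ne12 eqX; apply/rowP=> J; rewrite !mxE.
apply: (determinant_alternate ne12) => j; rewrite !mxE.
by have /rowP/(_ (tnth (enum_val J) j)) := eqX; rewrite !mxE.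
Qed.

Lemma increasing_tuple_inj k n (t : k.-tuple 'I_n) :
  t \in increasing_tuples k n -> injective (tnth t).
Proof.
rewrite inE => /(sorted_uniq ltn_trans ltnn); rewrite (map_inj_uniq val_inj).
by move/tuple_uniqP.
Qed.

Lemma increasing_tuple_eq k n (t u : k.-tuple 'I_n) :
  t \in increasing_tuples k n -> u \in increasing_tuples k n ->
  t =i u -> t = u.
Proof.
rewrite !inE => st su eqtu; apply/val_inj/(inj_map val_inj).
apply: (irr_sorted_eq ltn_trans ltnn) => // x.
by apply/mapP/mapP=> -[y yt ->]; exists y; rewrite // ?eqtu // -eqtu.
Qed.

Definition tuple_perm_fun k n (p : k.-tuple 'I_n * 'S_k) : {ffun 'I_k -> 'I_n} :=
  [ffun i => tnth p.1 (p.2 i)].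

Let D k n := setX (increasing_tuples k n) [set: 'S_k].

Lemma tuple_perm_fun_inj k n : {in D k n &, injective (@tuple_perm_fun k n)}.
Proof.
move=> [t s] [u r] /setXP[/= tI _] /setXP[/= uI _] /ffunP eqf.
have memE (v : k.-tuple 'I_n) (w : 'S_k) x :
    (x \in v) = [exists i, tnth v (w i) == x].
  apply/tnthP/existsP=> [[i ->]|[i /eqP <-]]; last by exists (w i).
  by exists (w^-1%g i); rewrite permKV.
have etu : t = u.
  apply: increasing_tuple_eq => // x; rewrite (memE _ s) (memE _ r).
  by apply: eq_existsb => i; have := eqf i; rewrite !ffunE /= => ->.
subst u; congr (_, _); apply/permP=> i; apply: (increasing_tuple_inj tI).
by have := eqf i; rewrite !ffunE.
Qed.

Lemma tuple_perm_fun_image k n :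
  @tuple_perm_fun k n @: D k n = [set f : {ffun 'I_k -> 'I_n} | injectiveb f].
Proof.
apply/eqP; rewrite eqEcard; apply/andP; split.
  apply/subsetP=> _ /imsetP[[t s] /setXP[/= tI _] ->].
  rewrite inE; apply/injectiveP=> i j; rewrite !ffunE /=.
  by move/(increasing_tuple_inj tI)/perm_inj.
rewrite (card_in_imset (@tuple_perm_fun_inj k n)) cardsX card_ltn_sorted_tuples.
by rewrite cardsT card_Sn card_inj_ffuns !card_ord bin_ffact.
Qed.

Lemma Cauchy_Binet k n (X : 'M[K]_(k, n)) (Y : 'M[K]_(n, k)) :
  \det (X *m Y) = \sum_(t in increasing_tuples k n)
                     \det (colsub (tnth t) X) * \det (rowsub (tnth t) Y).
Proof.
pose W (f : {ffun 'I_k -> 'I_n}) := (\prod_i X i (f i)) * \det (rowsub f Y).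
transitivity (\sum_f W f).
  transitivity (\sum_(f : {ffun 'I_k -> 'I_n}) \sum_(s : 'S_k)
     (-1) ^+ s * \prod_i (X i (f i) * Y (f i) (s i))).
    rewrite exchange_big /=; apply: eq_bigr => s _; rewrite -big_distrr /=.
    congr (_ * _); rewrite -(bigA_distr_bigA (fun i j => X i j * Y j (s i))) /=.
    by apply: eq_bigr => i _; rewrite mxE.
  apply: eq_bigr => f _; rewrite /W /(\det _) big_distrr /=.
  apply: eq_bigr => s _; rewrite big_split /= mulrCA; congr (_ * (_ * _)).
  by apply: eq_bigr => i _; rewrite mxE.
rewrite (bigID (fun f : {ffun 'I_k -> 'I_n} => injectiveb f)) /=.
rewrite [X in _ + X]big1 ?addr0 => [|f /injectivePn[i [j neij eqf]]]; last first.
  rewrite /W (determinant_alternate neij) ?mulr0 // => l.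
  by rewrite !mxE eqf.
transitivity (\sum_(f in @tuple_perm_fun k n @: D k n) W f).
  by apply: eq_bigl => f; rewrite tuple_perm_fun_image inE.
rewrite (big_imset _ (@tuple_perm_fun_inj k n)) /=.
rewrite (eq_bigl (fun p => (p.1 \in increasing_tuples k n) && true)); last first.
  by case=> t s; rewrite !inE.
rewrite -(pair_big (fun t => t \in increasing_tuples k n) xpredT
  (fun t s => W (tuple_perm_fun (t, s)))) /=.
apply: eq_bigr => t _; rewrite [\det (colsub _ _)]/(\det _) big_distrl /=.
apply: eq_bigr => s _; rewrite /W.
have ->: rowsub (tuple_perm_fun (t, s)) Y = row_perm s (rowsub (tnth t) Y).
  by apply/matrixP=> i j; rewrite !mxE ffunE.
rewrite row_permE det_mulmx det_perm mulrCA mulrA; congr (_ * _ * _).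
by apply: eq_bigr => i _; rewrite mxE ffunE.
Qed.

Lemma wedge_mulmx k n (X : 'M[K]_(k, n)) (A : 'M[K]_n) :
  wedge (X *m A) = wedge X *m extpow k A.
Proof.
apply/rowP=> J; rewrite !mxE.
have ->: colsub (tnth (enum_val J)) (X *m A) =
         X *m colsub (tnth (enum_val J)) A.
  by apply/matrixP=> i j; rewrite !mxE; apply: eq_bigr => l _; rewrite mxE.
rewrite Cauchy_Binet big_enum_val /=; apply: eq_bigr => I _; rewrite !mxE.
by congr (_ * \det _); apply/matrixP=> i j; rewrite !mxE.
Qed.

Lemma extpow1 k n : extpow k (1%:M : 'M[K]_n) = 1%:M.
Proof.
apply/matrixP=> I J; rewrite !mxE.
have tI := enum_valP I; have tJ := enum_valP J.
have [<-|neIJ] := eqVneq I J.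
  rewrite (_ : colsub _ _ = 1%:M) ?det1 //.
  by apply/matrixP=> i j; rewrite !mxE (inj_eq (increasing_tuple_inj tI)).
have [i iP] : exists i, tnth (enum_val I) i \notin (enum_val J : k.-tuple _).
  apply/existsP; apply: contraNT neIJ => /existsPn sIJ.
  apply/eqP/enum_val_inj/increasing_tuple_eq => //.
  have uI : uniq (enum_val I : k.-tuple _).
    by apply/tuple_uniqP/(increasing_tuple_inj tI).
  have uJ : uniq (enum_val J : k.-tuple _).
    by apply/tuple_uniqP/(increasing_tuple_inj tJ).
  have sub : {subset (enum_val I : k.-tuple _) <= (enum_val J : k.-tuple _)}.
    by move=> x /tnthP[i ->]; have := sIJ i; rewrite negbK.
  by have [|//] := uniq_min_size uI sub; rewrite !size_tuple.
rewrite (expand_det_row _ i) big1 // => j _; rewrite !mxE.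
case: eqP => [eij|_]; last by rewrite mul0r.
by rewrite eij mem_tnth in iP.
Qed.

Lemma extpowM k n (A B : 'M[K]_n) :
  extpow k (A *m B) = extpow k A *m extpow k B.
Proof.
apply/row_matrixP=> I; rewrite row_mul !rowK -wedge_mulmx; congr wedge.
by apply/matrixP=> i j; rewrite !mxE; apply: eq_bigr => l _; rewrite !mxE.
Qed.

Variables (gT : finGroupType) (G : {group gT}).
Variables (k n : nat) (rG : mx_representation K G n).

Lemma ext_mx_repr : mx_repr G (fun g => extpow k (rG g)).
Proof.
split=> [|x y Gx Gy]; first by rewrite repr_mx1 extpow1.
by rewrite repr_mxM // extpowM.
Qed.

Definition ext_repr := MxRepresentation ext_mx_repr.

End ExteriorPower.

Section TrivialModule.

Variables (K : fieldType) (gT : finGroupType) (G : {group gT}) (m : nat).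

Lemma triv_mx_repr : mx_repr G (fun _ : gT => 1%:M : 'M[K]_m).
Proof. by split=> // x y _ _; rewrite mulmx1. Qed.

Definition triv_repr := MxRepresentation triv_mx_repr.

End TrivialModule.

Section Induction.

Variables (K : fieldType) (gT : finGroupType) (H : {group gT}).
Variables (n : nat) (rH : mx_representation K H n).

Let G : {group gT} := [set: gT]%G.

Definition lmul_mx (h : gT) : 'M[K]_(gcard G) :=
  \matrix_i delta_mx 0 (gring_index G (h * enum_val i)%g).

(* W (x) K[G], on which G acts by right multiplication on K[G]. *)
Definition ind_tensor := prod_repr (triv_repr K G n) (regular_repr K G).

(* The span of the w h (x) g - w (x) h g, for w in W, h in H, g in G. *)
Definition ind_relations : 'M[K]_(n * gcard G) :=
  (\sum_(h in H) <<tprod (rH h) 1%:M - tprod 1%:M (lmul_mx h)>>)%MS.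

Lemma lmul_regular_mx h x :
  lmul_mx h *m regular_mx K G x = regular_mx K G x *m lmul_mx h.
Proof.
apply/row_matrixP=> i; rewrite !row_mul !rowK -!rowE !rowK.
by rewrite !gring_indexK ?inE // mulgA.
Qed.

Lemma ind_relations_module : mxmodule ind_tensor ind_relations.
Proof.
apply: sumsmx_module => h _; rewrite (eqmx_module _ (genmxE _)).
apply/mxmoduleP=> x _ /=.
rewrite mulmxBl -!tprodE !mulmx1 mul1mx lmul_regular_mx.
suff -> : tprod (rH h) (regular_mx K G x) -
          tprod 1%:M (regular_mx K G x *m lmul_mx h) =
    tprod (1%:M : 'M[K]_n) (regular_mx K G x) *m
      (tprod (rH h) 1%:M - tprod 1%:M (lmul_mx h)) by rewrite submxMl.
by rewrite mulmxBr -!tprodE !mul1mx mulmx1.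
Qed.

(* W (x)_K[H] K[G]. *)
Definition ind_repr := factmod_repr ind_relations_module.

End Induction.

Definition symgroup (X : finType) : {group {perm X}} := [set: {perm X}]%G.

Section StandardModule.

Variables (K : fieldType) (X : finType).

Definition nat_mx (s : {perm X}) : 'M[K]_#|X| :=
  \matrix_i delta_mx 0 (enum_rank (s (enum_val i))).

Lemma nat_mx_repr : mx_repr (symgroup X) nat_mx.
Proof.
split=> [|s t _ _]; apply/row_matrixP=> i; rewrite !rowK.
  by rewrite perm1 enum_valK row1.
by rewrite row_mul rowK -rowE rowK enum_rankK permM.
Qed.

Definition nat_repr := MxRepresentation nat_mx_repr.

(* The span of the differences e_x - e_y in the permutation module K^X: these *)
(* are the polytabloids of shape (n-1, 1), and the span is S^(n-1,1), of      *)
(* dimension n-1 (zero for n = 1).                                            *)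
Definition std_space : 'M[K]_#|X| :=
  (\sum_(p : X * X) <<delta_mx (0 : 'I_1) (enum_rank p.1)
                      - delta_mx (0 : 'I_1) (enum_rank p.2)>>)%MS.

Lemma std_module : mxmodule nat_repr std_space.
Proof.
apply/mxmoduleP=> s _; rewrite /std_space sumsmxMr; apply/sumsmx_subP=> -[x y] _.
rewrite (eqmxMr _ (genmxE _)) mulmxBl -!rowE !rowK !enum_rankK /=.
by apply: (sumsmx_sup (s x, s y)); rewrite ?genmxE.
Qed.

Definition std_repr := submod_repr std_module.

(* The piece of degree k of L_n, for X with n elements. *)
Definition L_repr (k : nat) := ext_repr k std_repr.

End StandardModule.

Section ChromaticModule.

Variables (K : fieldType) (V : finType).
Implicit Types (B : {set V}) (P : {set {set V}}).

(* The product of the S_B for B in P, when P is a partition of V. *)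
Definition young_group P : {group {perm V}} := (\bigcap_(B in P) 'N(B | 'P))%G.

Local Notation block B := {x : V | x \in B}.

(* The projection to S_B: it restricts to B the permutations stabilising B. *)
Definition block_action B := subaction (block B) (perm_action V).

Definition block_perm B := actperm_morphism (block_action B).

Lemma young_block P B :
  B \in P -> young_group P \subset block_perm B @*^-1 (symgroup (block B)).
Proof.
move=> PB; rewrite morphpreT /= /subact_dom; apply/subsetP=> s.
move/bigcapP=> /(_ B PB); suff -> : [set x | x \in B] = B by [].
by apply/setP=> x; rewrite inE.
Qed.

Local Notation rep P := (representation K (young_group P)).

Definition L_block P (B : {B | B \in P}) (k : nat) : rep P :=
  Representation (subg_repr
    (morphpre_repr (block_perm (val B)) (L_repr K (block (val B)) k))
    (young_block (valP B))).

Definition gtens P (A1 A2 : nat -> rep P) (k : nat) : rep P :=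
  \big[dadd_grepr/grepr0]_(i < k.+1)
     Representation (prod_repr (A1 i) (A2 (k - i)%N)).

Definition gunit P (k : nat) : rep P :=
  if k is 0%N then Representation (triv_repr K (young_group P) 1) else grepr0.

Definition L_tensor P : nat -> rep P :=
  \big[@gtens P/@gunit P]_(B : {B | B \in P}) L_block B.

Definition gmod := int -> representation K (symgroup V).

Definition M_gmod P : gmod := fun j =>
  if j is Posz k then Representation (ind_repr (L_tensor P k)) else grepr0.

(* Degree-preserving homomorphisms, as matrices acting on row vectors: the    *)
(* composite "f, then g" is f j *m g j.                                       *)
Record ghom (A B : gmod) := GHom {
  ghom_mx :> forall j, 'M[K]_(rdegree (A j), rdegree (B j));
  ghomP : forall j s, A j s *m ghom_mx j = ghom_mx j *m B j s
}.

Lemma gid_subproof (A : gmod) j s : A j s *m 1%:M = 1%:M *m A j s.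
Proof. by rewrite mulmx1 mul1mx. Qed.

Definition gid (A : gmod) : ghom A A := GHom (@gid_subproof A).

(* The identity map of M_P = M_Q, for equal partitions P and Q.               *)
Definition gid_of_eq P Q (e : P = Q) : ghom (M_gmod P) (M_gmod Q) :=
  eq_rect P (fun Q => ghom (M_gmod P) (M_gmod Q)) (gid (M_gmod P)) Q e.

End ChromaticModule.

Section Graph.

Variable V : finType.
Implicit Types (E T : {set {set V}}) (e : {set V}).

Definition is_graph E := [forall e in E, #|e| == 2%N].

Definition adj T : rel V := fun x y => [set x; y] \in T.

Definition components T : {set {set V}} :=
  equivalence_partition (connect (adj T)) [set: V].

Definition connected_graph E := #|components E| == 1%N.

Definition completes_cycle T e := exists c : seq V,
  [/\ (2 < size c)%N, ucycle (adj (e |: T)) c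
    & exists2 x, x \in c & e = [set x; next c x]].

End Graph.

Section ChromaticHomology.

Variables (K : fieldType) (V : finType) (E : {set {set V}}).
Implicit Types (S T U : {set {set V}}) (e : {set V}).

Local Notation M T := (M_gmod K (components T)).

(* Functors on the poset of subsets of E with the prescribed objects and the  *)
(* prescribed maps on the covers that complete a cycle.  Only the values      *)
(* cs_map S T with S \subset T \subset E matter.                              *)
Record chromatic_functor := ChromaticFunctor {
  cs_map :> forall S T, ghom (M S) (M T);
  cs_map_id : forall T, T \subset E -> forall j, cs_map T T j = 1%:M;
  cs_map_comp : forall S T U, S \subset T -> T \subset U -> U \subset E ->
    forall j, cs_map S U j = cs_map S T j *m cs_map T U j;
  cs_map_cycle : forall T e, T \subset E -> e \in E -> e \notin T ->
    completes_cycle T e ->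
    exists eqc : components T = components (e |: T),
      forall j, cs_map T (e |: T) j = gid_of_eq K eqc j
}.

(* es lists the edges of E in their fixed order. *)
Variables (es : seq {set V}) (F : chromatic_functor).

Definition covers S T := (S \subset T) && (#|T :\: S| == 1%N).

(* (-1)^#{f in S : f comes before e}, where T = S u {e}. *)
Definition cover_sign S T : K :=
  (-1) ^+ #|[set f in S | [exists e in T :\: S, (index f es < index e es)%N]]|.

Definition edge_sets (i : int) : {set {set {set V}}} :=
  [set T : {set {set V}} | (T \subset E) && (#|T|%:Z == i)].

Definition cochain_size (i j : int) (a : 'I_#|edge_sets i|) : nat :=
  rdegree (M (enum_val a) j).

(* C^i in internal degree j: the direct sum of the M_T with #|T| = i. *)
Definition cochain_mx (i j : int) (s : {perm V}) :
    'M[K]_(\sum_a cochain_size (i := i) j a) :=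
  \mxdiag_(a < #|edge_sets i|) M (enum_val a) j s.

Lemma cochain_mx_repr i j : mx_repr (symgroup V) (cochain_mx i j).
Proof.
split=> [|s t _ _].
  by rewrite -mxdiagZ; apply: eq_mxdiag => a; rewrite repr_mx1.
rewrite [RHS]mul_mxblock_mxdiag; apply/eq_mxblock => a b.
rewrite repr_mxM ?inE //; case: eqP => [e|_]; last by rewrite mul0mx.
by subst b; rewrite /conform_mx; case: eqP => // e; rewrite !eq_axiomK.
Qed.

Definition cochain_repr i j := MxRepresentation (cochain_mx_repr i j).

(* The differential C^i -> C^k, in internal degree j, for k = i + 1. *)
Definition diff_mx (i k j : int) : 'M[K]_(\sum_a cochain_size (i := i) j a,
                                          \sum_b cochain_size (i := k) j b) :=
  \mxblock_(a < #|edge_sets i|, b < #|edge_sets k|)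
     (if covers (enum_val a) (enum_val b)
      then cover_sign (enum_val a) (enum_val b)
             *: F (enum_val a) (enum_val b) j
      else 0).

Lemma diff_mx_hom i k j s :
  cochain_repr i j s *m diff_mx i k j = diff_mx i k j *m cochain_repr k j s.
Proof.
rewrite /= mul_mxdiag_mxblock mul_mxblock_mxdiag; apply/eq_mxblock => a b.
case: ifP => _; last by rewrite mulmx0 mul0mx.
by rewrite -scalemxAr ghomP scalemxAl.
Qed.

Definition cocycles i j := kermx (diff_mx i (i + 1) j).

Definition coboundaries i j := <<diff_mx (i - 1) i j>>%MS.

Lemma cocycles_module i j : mxmodule (cochain_repr i j) (cocycles i j).
Proof.
apply/mxmoduleP=> s _; apply/sub_kermxP.
by rewrite -mulmxA diff_mx_hom mulmxA mulmx_ker mul0mx.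
Qed.

Lemma coboundaries_module i j : mxmodule (cochain_repr i j) (coboundaries i j).
Proof.
rewrite (eqmx_module _ (genmxE _)); apply/mxmoduleP=> s _.
by rewrite -diff_mx_hom submxMl.
Qed.

(* Cocycles modulo coboundaries: section_repr divides the second module by    *)
(* the first.                                                                 *)
Definition chromatic_homology (i j : int) : representation K (symgroup V) :=
  Representation
    (section_repr (coboundaries_module i j) (cocycles_module i j)).

End ChromaticHomology.

(* Main.v *)
(* Since L_b lives in degrees 0..b-1, M_T lives in degrees 0..|V|-#|components T|, *)
(* and |V| - #|components T| <= |T|; this settles j < 0, j > i and i < 0.          *)
(* For i >= |V| every edge set T of size i contains a cycle, hence a broken        *)
(* circuit.  Let e be the first edge of es that spans, together with later edges   *)
(* of T, a cycle.  Toggling e does not change e, and F(T - e -> T + e) is the      *)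
(* identity; this perfect matching of the edge sets in degree i is triangular with *)
(* respect to the position of e, so the complex is exact there.                    *)

Require Import Defs.
From mathcomp Require Import all_boot all_order all_algebra all_fingroup.
From mathcomp Require Import mxrepresentation character reals.
From mathcomp.real_closed Require Import complex.
From mathcomp Require Import zify.

Set Implicit Arguments.
Unset Strict Implicit.
Unset Printing Implicit Defensive.

Import Order.TTheory GRing.Theory Num.Theory.
Local Open Scope ring_scope.

(** The vanishing has two sources. In homological degrees below [#|V|] the cochain modules
    themselves are zero outside the range: by [rdegree_M_gmod] the module of [T] lives in internal
    degrees 0 to [#|V| - #|components T|], and [card_components_ge] bounds the latter by [#|T|].

    From degree [#|V|] on, the complex is exact. An edge set that large has an edge whose ends are
    joined by later edges of the set ([has_broken]); its pivot is the first such edge. Toggling the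
    pivot does not change it ([find_broken_addU1], [find_broken_setD1]), so edge sets come in pairs,
    and along a pair the differential is a sign times an identity ([diff_block_unit]). Any other
    block from a set without its pivot to a set with its pivot vanishes unless the pivot of the
    source is strictly later ([diff_block_eq0]). This triangularity lets [matching_exact], a form of
    Gaussian elimination, show that cocycles are coboundaries. *)

(** * Internal degrees in which the modules live *)

Section DegreeBound.

Variable K : fieldType.

Lemma extdim_eq0 k n : (n < k)%N -> extdim k n = 0%N.
Proof. by move=> lt_nk; rewrite /extdim card_ltn_sorted_tuples bin_small. Qed.

(** Differences of basis vectors lie in the kernel of the coordinate sum [u], which is nonzero once
    [X] is nonempty. *)
Lemma rank_std_space (X : finType) : (\rank (std_space K X) <= #|X|.-1)%N.
Proof.
pose u : 'cV[K]_#|X| := const_mx 1.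
have sub : (std_space K X <= kermx u)%MS.
  apply/sumsmx_subP=> -[x y] _; rewrite genmxE; apply/sub_kermxP.
  by rewrite mulmxBl -!rowE; apply/rowP=> i; rewrite !mxE subrr.
apply: leq_trans (mxrankS sub) _; rewrite mxrank_ker.
case: (posnP #|X|) => [X0|X_gt0]; first by rewrite (leq_trans (leq_subr _ _)) ?X0.
rewrite -subn1 leq_sub2l // lt0n mxrank_eq0.
by apply/eqP=> /colP/(_ (Ordinal X_gt0)); rewrite !mxE; apply/eqP/oner_neq0.
Qed.

Lemma rdegree_dsum (gT : finGroupType) (G : {group gT}) I (r : seq I)
    (A : I -> representation K G) :
  rdegree (\big[dadd_grepr/grepr0]_(i <- r) A i) = (\sum_(i <- r) rdegree (A i))%N.
Proof. exact: (big_morph (@rdegree K gT G)). Qed.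

Lemma rdegree_ind_eq0 (gT : finGroupType) (H : {group gT}) n
    (rH : mx_representation K H n) :
  n = 0%N -> rdegree (Representation (ind_repr rH)) = 0%N.
Proof.
move=> n0; apply/eqP; rewrite -leqn0 /=.
by apply: leq_trans (rank_leq_row _) _; rewrite n0.
Qed.

Variable V : finType.
Implicit Type P : {set {set V}}.

(** A summand of degree [k] takes degree [i] from one block and [k - i] from the others; beyond the
    sum of the top degrees, one of the two factors is zero. *)
Lemma rdegree_L_tensor P k :
  (\sum_(B in P) #|B|.-1 < k)%N -> rdegree (L_tensor K P k) = 0%N.
Proof.
rewrite /L_tensor.
have -> : (\sum_(B in P) #|B|.-1 = \sum_(B : {B | B \in P}) #|val B|.-1)%N.
  exact: (big_sub (mem P) (fun B => #|B|.-1)).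
rewrite /index_enum; elim: (Finite.enum _) k => [|B r IHr] k.
  by rewrite !big_nil; case: k.
rewrite !big_cons => lt_k; rewrite rdegree_dsum big1 // => i _ /=.
have [lt_i|le_i] := ltnP #|val B|.-1 i.
  rewrite extdim_eq0 //=; apply: leq_ltn_trans lt_i.
  by apply: leq_trans (rank_std_space _) _; rewrite card_sig.
rewrite IHr ?muln0 //; rewrite ltn_subRL.
by apply: leq_ltn_trans lt_k; rewrite leq_add2r.
Qed.

Lemma card_partition_pred P :
  partition P [set: V] -> (\sum_(B in P) #|B|.-1 + #|P| = #|V|)%N.
Proof.
move=> partP; rewrite -cardsT (card_partition partP) -sum1_card -big_split /=.
apply: eq_bigr => B PB; rewrite addn1 prednK // card_gt0.
by apply: contraTneq PB => ->; case/and3P: partP.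
Qed.

Lemma rdegree_M_gmod P (j : int) :
  partition P [set: V] -> ~~ (0 <= j <= #|V|%:Z - #|P|%:Z) ->
  rdegree (M_gmod K P j) = 0%N.
Proof.
move=> partP; case: j => [k|//]; rewrite -(card_partition_pred partP).
rewrite PoszD addrK lez_nat -ltnNge => lt_k.
by apply: rdegree_ind_eq0; apply: rdegree_L_tensor.
Qed.

End DegreeBound.

(** * Components and connectivity when an edge is added *)

Section Components.

Variable V : finType.
Implicit Types (S T : {set {set V}}) (e : {set V}).

Lemma connect_adj_sym T : connect_sym (adj T).
Proof. by apply: sym_connect_sym => x y; rewrite /adj setUC. Qed.

Lemma adj_addU1 T e x y : adj (e |: T) x y = ([set x; y] == e) || adj T x y.
Proof. by rewrite /adj in_setU1. Qed.

Lemma connect_adjS S T :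
  S \subset T -> subrel (connect (adj S)) (connect (adj T)).
Proof. by move=> /subsetP sST; apply: connect_sub => x y Sxy; exact/connect1/sST. Qed.

Lemma components_partition T : partition (components T) [set: V].
Proof.
apply: equivalence_partitionP => x y z _ _ _.
by split=> [|/(same_connect (@connect_adj_sym T))->].
Qed.

Lemma card_components (X : finType) (h : V -> X) T :
  (forall x y, connect (adj T) x y = (h x == h y)) ->
  #|components T| = #|[set h x | x : V]|.
Proof.
move=> hP; have -> : components T = [set h @^-1: [set h x] | x : V].
  apply/setP=> B; apply/imsetP/imsetP=> -[x _ ->]; exists x => //;
    by apply/setP=> y; rewrite !inE hP eq_sym.
rewrite (imset_comp (fun c => h @^-1: [set c]) h) card_in_imset //.
move=> _ _ /imsetP[x _ ->] /imsetP[y _ ->] /setP/(_ x).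
by rewrite !inE eqxx => /esym/eqP.
Qed.

(** A label for the classes after joining [x] to [y]: the class of [y] takes over the root of [x].
    Connectivity becomes equality of labels, the form that [card_components] counts. *)
Definition merge_root T x y z :=
  if connect (adj T) y z then fingraph.root (adj T) x else fingraph.root (adj T) z.

Lemma connect_addU1 T x y u v :
  connect (adj ([set x; y] |: T)) u v = (merge_root T x y u == merge_root T x y v).
Proof.
set e := [set x; y]; set T' := e |: T.
have symT := @connect_adj_sym T; have symT' := @connect_adj_sym T'.
have sub : subrel (connect (adj T)) (connect (adj T')).
  exact/connect_adjS/subsetUr.
have Exy : connect (adj T') x y by apply: connect1; rewrite /adj !inE eqxx.
apply/idP/idP.
  have step a b : adj T' a b -> merge_root T x y a == merge_root T x y b.
    rewrite adj_addU1 => /orP[/eqP eq_ab|/connect1 Cab]; last first.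
      by rewrite /merge_root (same_connect_r symT Cab) (fingraph.rootP symT Cab).
    have hxy : merge_root T x y x = merge_root T x y y.
      by rewrite /merge_root connect0; case: ifP.
    have : (a \in e) && (b \in e) by rewrite -eq_ab !inE !eqxx orbT.
    by rewrite !inE => /andP[/orP[]/eqP-> /orP[]/eqP->]; rewrite ?eqxx ?hxy.
  case/connectP=> p + ->; elim: p u => //= w p IHp u /andP[/step/eqP-> /IHp].
  by [].
(* Conversely, each vertex is connected to its own label. *)
have to_root w : connect (adj T') w (merge_root T x y w).
  rewrite /merge_root; case: ifP => [Cyw|_]; last exact/sub/connect_root.
  apply: connect_trans (sub _ _ (connect_root _ x)).
  by rewrite symT' (connect_trans Exy) // sub.
by move/eqP=> eq_uv; apply: connect_trans (to_root u) _; rewrite eq_uv symT'.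
Qed.

(** If [x] and [y] are already connected, no label changes; otherwise exactly the root of [y]
    disappears from the labels. *)
Lemma card_components_addU1 T x y :
  (#|components ([set x; y] |: T)| + ~~ connect (adj T) x y)%N = #|components T|.
Proof.
have symT := @connect_adj_sym T.
rewrite (card_components (connect_addU1 T x y)).
rewrite (@card_components _ (fingraph.root (adj T)) T) => [|u v]; last first.
  by rewrite fingraph.root_connect.
set R := [set fingraph.root _ _ | _ in _].
have [Cxy|nCxy] := boolP (connect (adj T) x y).
  rewrite addn0; congr #|pred_of_set _|; apply: eq_imset => z.
  rewrite /merge_root; case: ifP => // Cyz; apply/eqP.
  by rewrite fingraph.root_connect // (connect_trans Cxy).
have Ry : fingraph.root (adj T) y \in R by apply: imset_f.
rewrite (cardsD1 (fingraph.root (adj T) y) R) Ry addnC; congr (1 + _)%N.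
congr #|pred_of_set _|; apply/setP=> w; rewrite !inE.
apply/imsetP/andP=> [[z _ ->]|[neq_wy /imsetP[z _ def_w]]].
  rewrite /merge_root; case: ifPn => [_|nCyz].
    by rewrite fingraph.root_connect // nCxy imset_f.
  by rewrite eq_sym fingraph.root_connect // nCyz imset_f.
exists z => //; rewrite def_w in neq_wy *; rewrite /merge_root.
by rewrite eq_sym fingraph.root_connect // in neq_wy; rewrite (negPf neq_wy).
Qed.

Definition spanned T e := [forall x in e, forall y in e, connect (adj T) x y].

Lemma spannedS S T e : S \subset T -> spanned S e -> spanned T e.
Proof.
move=> sST spS; apply/forall_inP=> x ex; apply/forall_inP=> y ey.
apply: connect_adjS sST _ _ _.
by have /forall_inP/(_ y ey) := forall_inP spS x ex.
Qed.

Lemma spanned2 T x y : spanned T [set x; y] = connect (adj T) x y.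
Proof.
apply/forall_inP/idP=> [/(_ x) spT|Cxy u].
  by have /forall_inP := spT (set21 x y); apply; apply: set22.
by rewrite !inE => /orP[]/eqP->; apply/forall_inP=> v;
  rewrite !inE => /orP[]/eqP->; rewrite ?connect0 // connect_adj_sym.
Qed.

(** Each passage through [e] is rerouted along a path of [T]. *)
Lemma spanned_addU1 T e f : spanned T e -> spanned (e |: T) f -> spanned T f.
Proof.
move=> spT spf; apply/forall_inP=> u fu; apply/forall_inP=> v fv.
apply: connect_sub (forall_inP (forall_inP spf u fu) v fv) => a b {u v fu fv}.
rewrite adj_addU1 => /orP[/eqP eq_ab|/connect1//].
have [ea eb] : a \in e /\ b \in e by rewrite -eq_ab !inE !eqxx orbT.
exact: forall_inP (forall_inP spT a ea) b eb.
Qed.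

Lemma spanned_completes_cycle T e :
  #|e| = 2%N -> e \notin T -> spanned T e -> completes_cycle T e.
Proof.
move=> /eqP/cards2P[x [y [neq_xy ->{e}]]] nTe; rewrite spanned2.
case/connectP=> p0 /shortenP[p path_p Up _] def_y.
exists (x :: p); split.
(* The path is not empty, as [x != y], and is not the single edge [e], as [e \notin T]; so the cycle
   has at least three vertices. *)
- move: def_y path_p => {Up}; case: p => [|z [|//]] /= def_y.
    by rewrite def_y eqxx in neq_xy.
  by rewrite -def_y /adj (negPf nTe).
- rewrite /ucycle Up andbT /= rcons_path -def_y; apply/andP; split.
    by apply: sub_path path_p => a b; rewrite adj_addU1 orbC => ->.
  by rewrite /adj setUC !inE eqxx.
- exists y; first by rewrite def_y mem_last.
  (* As [y] is the last vertex, [next] falls back on the default of [nth], the head [x]. *)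
  rewrite next_nth def_y mem_last index_last // -def_y.
  by rewrite nth_default // setUC.
Qed.

Variable E : {set {set V}}.
Hypothesis graphE : is_graph E.

Lemma card_graph_edge e : e \in E -> #|e| = 2%N.
Proof. by move=> Ee; apply/eqP/(forall_inP graphE). Qed.

Lemma graph_edgeP e : e \in E -> exists x y, e = [set x; y].
Proof.
by move/card_graph_edge/eqP/cards2P=> [x [y [_ ->]]]; exists x, y.
Qed.

Lemma card_components0 : #|components (set0 : {set {set V}})| = #|V|.
Proof.
rewrite (@card_components _ id) => [|x y]; first by rewrite card_imset.
apply/idP/eqP=> [|->]; last exact: connect0.
by case/connectP=> -[|z p] //=; rewrite /adj inE.
Qed.

(** Deleting an edge creates at most one new component. *)
Lemma card_components_ge T : T \subset E -> (#|V| <= #|components T| + #|T|)%N.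
Proof.
move: {2}#|T| (leqnn #|T|) => k; elim: k T => [|k IHk] T.
  by rewrite leqn0 cards_eq0 => /eqP-> _; rewrite card_components0 leq_addr.
have [->|[e Te]] := set_0Vmem T; first by rewrite card_components0 leq_addr.
move=> le_Tk sTE; have [x [y def_e]] := graph_edgeP (subsetP sTE e Te).
have le_De : (#|T :\ e| <= k)%N by rewrite (cardsD1 e) Te in le_Tk.
apply: leq_trans (IHk _ le_De (subset_trans (subD1set T e) sTE)) _.
rewrite -(card_components_addU1 (T :\ e) x y) -def_e setD1K //
  [in leqRHS](cardsD1 e T) Te.
by rewrite -addnA leq_add2l leq_add2r leq_b1.
Qed.

(** * Broken edges and the pivot of an edge set *)

Variable es : seq {set V}.
Hypothesis enumE : perm_eq es (enum E).

Lemma mem_edges e : (e \in es) = (e \in E).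
Proof. by rewrite (perm_mem enumE) mem_enum. Qed.

Lemma index_edge_inj : {in E &, injective (index^~ es)}.
Proof.
move=> e f Ee Ef eq_ef.
by rewrite -[e](nth_index set0 (s := es)) ?mem_edges // eq_ef nth_index ?mem_edges.
Qed.

(* [S] contains a circuit through [e], with first edge [e], possibly without [e]. *)
Definition broken S e := spanned [set f in S | (index e es < index f es)%N] e.

Definition pivot S := nth set0 es (find (broken S) es).

Lemma brokenS S T : S \subset T -> subpred (broken S) (broken T).
Proof.
move=> /subsetP sST e; apply: spannedS; apply/subsetP=> f.
by rewrite !inE => /andP[/sST-> ->].
Qed.

Lemma broken_setD1 S e : broken (S :\ e) e = broken S e.
Proof.
rewrite /broken; congr spanned; apply/setP=> f; rewrite !inE.
by have [->|] := eqVneq f e; rewrite ?ltnn ?andbF.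
Qed.

(** The edges that reroute a path around [e] are later than [e], hence later than [f]. *)
Lemma broken_addU1 S e f : broken S e -> (index f es < index e es)%N ->
  broken (e |: S) f -> broken S f.
Proof.
move=> brSe lt_fe brSf; apply: (@spanned_addU1 _ e).
  apply: spannedS brSe; apply/subsetP=> g; rewrite !inE => /andP[->].
  exact: ltn_trans.
apply: spannedS brSf; apply/subsetP=> g; rewrite !inE.
by case: eqP.
Qed.

Section Pivot.

Variable S : {set {set V}}.
Hypothesis brS : has (broken S) es.

Lemma pivot_in : pivot S \in E.
Proof. by rewrite -mem_edges mem_nth // -has_find. Qed.

Lemma index_pivot : index (pivot S) es = find (broken S) es.
Proof.
by rewrite index_uniq -?has_find // (perm_uniq enumE) enum_uniq.
Qed.

Lemma broken_pivot : broken S (pivot S).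
Proof. exact: nth_find. Qed.

(** Adding edges cannot delay the first broken edge, and by [broken_addU1] adding the pivot breaks
    no edge before it. *)
Lemma find_broken_addU1 : find (broken (pivot S |: S)) es = find (broken S) es.
Proof.
apply/eqP; rewrite eqn_leq sub_find /=; last exact/brokenS/subsetUr.
rewrite leqNgt; apply/negP=> lt_find.
set S' := pivot S |: S in lt_find *.
have brS' : has (broken S') es.
  by rewrite has_find (ltn_trans lt_find) // -has_find.
have := before_find set0 lt_find.
rewrite (broken_addU1 broken_pivot _ (nth_find set0 brS')) //.
rewrite index_pivot index_uniq //; first by rewrite -has_find.
by rewrite (perm_uniq enumE) enum_uniq.
Qed.

(** Deleting edges cannot advance the first broken edge, and the pivot stays broken because [broken]
    looks only at strictly later edges. *)
Lemma find_broken_setD1 : find (broken (S :\ pivot S)) es = find (broken S) es.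
Proof.
apply/eqP; rewrite eqn_leq andbC sub_find /=; last exact/brokenS/subD1set.
rewrite leqNgt; apply/negP=> /(before_find set0).
by rewrite -/(pivot S) broken_setD1 broken_pivot.
Qed.

Lemma spanned_pivot : spanned (S :\ pivot S) (pivot S).
Proof.
apply: spannedS broken_pivot; apply/subsetP=> f; rewrite !inE.
by case/andP=> -> /=; have [->|//] := eqVneq; rewrite ltnn.
Qed.

End Pivot.

Lemma pivot_setD1 S : has (broken S) es -> pivot (S :\ pivot S) = pivot S.
Proof. by move=> brS; rewrite {1}/pivot find_broken_setD1. Qed.

(** Without broken edges [S] is a forest, so each edge lowers the number of components by exactly
    one. *)
Lemma card_components_le S : S \subset E -> ~~ has (broken S) es ->
  (#|components S| + #|S| <= #|V|)%N.
Proof.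
move: {2}#|S| (leqnn #|S|) => k; elim: k S => [|k IHk] S.
  by rewrite leqn0 cards_eq0 => /eqP-> _; rewrite card_components0 cards0 addn0.
have [->|[e0 Se0]] := set_0Vmem S; first by rewrite card_components0 cards0 addn0.
move=> le_Sk sSE nbrS.
(* All other edges of [S] come after the earliest edge [e], so a path in [S :\ e] between its ends
   would make [e] broken. *)
case: (arg_minnP (P := fun e => e \in S) (index^~ es) Se0) => e Se min_e {e0 Se0}.
have [x [y def_e]] := graph_edgeP (subsetP sSE e Se).
have le_De : (#|S :\ e| <= k)%N by rewrite (cardsD1 e) Se in le_Sk.
have nbrD : ~~ has (broken (S :\ e)) es.
  by apply: contra nbrS; apply: sub_has; apply: brokenS; apply: subD1set.
apply: leq_trans (IHk _ le_De (subset_trans (subD1set S e) sSE) nbrD).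
rewrite -(card_components_addU1 (S :\ e) x y) -def_e setD1K // (cardsD1 e S) Se.
suff -> : ~~ connect (adj (S :\ e)) x y by rewrite addnA.
rewrite -spanned2 -def_e; apply: contra nbrS => spe; apply/hasP; exists e.
  by rewrite mem_edges (subsetP sSE).
apply: spannedS spe; apply/subsetP=> f; rewrite !inE => /andP[nef Sf].
rewrite Sf ltn_neqAle min_e // andbT; apply: contra nef => /eqP eq_ef.
by rewrite (index_edge_inj _ _ eq_ef) ?(subsetP sSE).
Qed.

End Components.

(** * Exactness from a triangular matching of blocks *)

Section Matching.

Variables (K : fieldType) (l m q : nat).
Variables (p0 : 'I_l -> nat) (p1 : 'I_m -> nat) (p2 : 'I_q -> nat).
Variables (D : forall a b, 'M[K]_(p0 a, p1 b)).
Variables (D' : forall b c, 'M[K]_(p1 b, p2 c)).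

(** Blocks are cleared by decreasing [r]: a combination of the rows in block row [a] kills block [b]
    and leaves the blocks cleared before untouched. *)
Lemma clear_matched_blocks (A : pred 'I_m) (r : 'I_m -> nat) :
  (forall b, A b -> exists2 a, row_full (D a b) &
     forall b', A b' -> b' != b -> (r b <= r b')%N -> D a b' = 0) ->
  forall n (z : 'M_(n, _)), exists2 w, (w <= \mxblock_(a, b) D a b)%MS
    & forall b, A b -> submxrow (z - w) b = 0.
Proof.
move=> matchA n z; pose le_r b b' := (r b <= r b')%N.
have : {subset A <= sort le_r (enum A)} by move=> b; rewrite mem_sort mem_enum.
have : all A (sort le_r (enum A)).
  by apply/allP=> b; rewrite mem_sort mem_enum.
have : sorted le_r (sort le_r (enum A)).
  by apply: sort_sorted => b b'; apply: leq_total.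
have : uniq (sort le_r (enum A)) by rewrite sort_uniq enum_uniq.
move: (sort _ _) => s Us sorted_s As sub_s.
suff [w wD w0] : exists2 w, (w <= \mxblock_(a, b) D a b)%MS
    & {in s, forall b, submxrow (z - w) b = 0}.
  by exists w => // b /sub_s/w0.
elim: s Us sorted_s As {sub_s} => [|b s IHs] /=; first by exists 0; rewrite ?sub0mx.
case/andP=> nsb Us path_s /andP[Ab As].
have [w wD w0] := IHs Us (path_sorted path_s) As.
have [a full_a D0] := matchA b Ab.
have /submxP[u zb] := submx_full (submxrow (z - w) b) full_a.
have le_rb : all (le_r b) s.
  by apply: order_path_min path_s => ? ? ?; apply: leq_trans.
exists (w + u *m \mxrow_b' D a b') => [|b'].
  rewrite addmx_sub // mulmx_sub // -(submxcol_matrix D); exact: rowsub_sub.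
rewrite inE opprD addrA submxrowB mul_mxrow mxrowK.
have [-> _|neb /= sb'] := eqVneq b' b; first by rewrite zb subrr.
rewrite w0 // D0 ?mulmx0 ?subr0 //; first exact: (allP As).
exact: (allP le_rb).
Qed.

(** At a nonzero block of [z] with maximal [r], the matched column [c] sees that block alone, and
    [row_free] forces it to vanish. *)
Lemma unmatched_cocycle_eq0 (A : pred 'I_m) (r : 'I_m -> nat) n (z : 'M_(n, _)) :
  (forall b, A b -> exists2 c, row_free (D' b c) &
     forall b', A b' -> b' != b -> (r b' <= r b)%N -> D' b' c = 0) ->
  (forall b, ~~ A b -> submxrow z b = 0) ->
  z *m \mxblock_(b, c) D' b c = 0 -> z = 0.
Proof.
move=> matchA zA; rewrite -{1}(submxrowK z) mul_mxrow_mxblock => zD'.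
apply/mxrowP=> b; rewrite submxrow0.
apply/eqP; apply/negPn/negP=> nzb.
case: (arg_maxnP r (i0 := b) (P := fun b => submxrow z b != 0)) => // {nzb}b nzb max_b.
have Ab : A b by apply: contraNT nzb => /zA->.
have [c free_c D0] := matchA b Ab.
have /(congr1 (fun y => submxrow y c)) := zD'.
rewrite mxrowK submxrow0 (bigD1 b) //= big1 => [|b' neb]; last first.
  have [->|nzb'] := eqVneq (submxrow z b') 0; first by rewrite mul0mx.
  rewrite D0 ?mulmx0 //; first by apply: contraNT nzb' => /zA->.
  exact: max_b.
rewrite addr0 -(mul0mx _ (D' b c)) => /(row_free_inj free_c) zb.
by rewrite zb eqxx in nzb.
Qed.

(* Algebraic Morse theory without critical cells: the indices in [A] are       *)
(* matched through [D], the others through [D'], and [r] makes the matched      *)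
(* blocks of both triangular with invertible diagonal.                          *)
Lemma matching_exact (A : pred 'I_m) (r : 'I_m -> nat) :
  (\mxblock_(a, b) D a b) *m (\mxblock_(b, c) D' b c) = 0 ->
  (forall b, A b -> exists2 a, row_full (D a b) &
     forall b', A b' -> b' != b -> (r b <= r b')%N -> D a b' = 0) ->
  (forall b, ~~ A b -> exists2 c, row_free (D' b c) &
     forall b', ~~ A b' -> b' != b -> (r b' <= r b)%N -> D' b' c = 0) ->
  (kermx (\mxblock_(b, c) D' b c) <= \mxblock_(a, b) D a b)%MS.
Proof.
move=> DD' matchD matchD'; set Z := kermx _.
have [w wD Zw] := clear_matched_blocks matchD Z.
suff /eqP : Z - w = 0 by rewrite subr_eq0 => /eqP->.
apply: (unmatched_cocycle_eq0 matchD') => [b|]; first by rewrite negbK => /Zw.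
rewrite mulmxBl mulmx_ker sub0r; have /submxP[u ->] := wD.
by rewrite -mulmxA DD' mulmx0 oppr0.
Qed.

End Matching.

(** * Signs, and the differential squares to zero *)

Section Differential.

Variables (K : fieldType) (V : finType) (E : {set {set V}}).
Implicit Types (S T U : {set {set V}}) (e f : {set V}).
Variables (es : seq {set V}) (F : chromatic_functor K E).
Hypothesis enumE : perm_eq es (enum E).

Lemma coversP S T : reflect (exists2 e, e \notin S & T = e |: S) (covers S T).
Proof.
apply: (iffP andP) => [[sST /cards1P[e def_e]]|[e nSe ->]].
  have : e \in T :\: S by rewrite def_e set11.
  rewrite inE => /andP[nSe _]; exists e => //.
  by rewrite -def_e -{1}(setID T S) (setIidPr sST) setUC.
rewrite subsetUr; split=> //; apply/cards1P; exists e.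
by apply/setP=> f; rewrite !inE; case: eqP => [->|]; rewrite ?nSe //= andNb.
Qed.

Definition edges_before e S := [set f in S | (index f es < index e es)%N].

Lemma cover_sign_setU1 S e : e \notin S ->
  cover_sign K es S (e |: S) = (-1) ^+ #|edges_before e S|.
Proof.
move=> nSe; rewrite /cover_sign; congr (_ ^+ #|pred_of_set _|).
apply/setP=> f; rewrite !inE; congr (_ && _).
apply/exists_inP/idP=> [[g]|lt_fe]; last by exists e; rewrite // !inE eqxx nSe.
by rewrite !inE => /andP[/negPf nSg]; rewrite nSg orbF => /eqP->.
Qed.

Lemma card_edges_before_setU1 S e f : f \notin S ->
  #|edges_before e (f |: S)| =
    ((index f es < index e es)%N + #|edges_before e S|)%N.
Proof.
move=> nSf; have -> : edges_before e (f |: S) =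
    if (index f es < index e es)%N then f |: edges_before e S else edges_before e S.
  apply/setP=> x; rewrite !inE; case: ifP => lt_fe; rewrite !inE;
    by have [->|//] := eqVneq x f; rewrite lt_fe ?(negPf nSf).
by case: ifP => _; rewrite // cardsU1 !inE (negPf nSf).
Qed.

(** The edge added first is counted again with the second exactly when it comes earlier in [es],
    which happens in just one of the two orders. *)
Lemma cover_sign_swap S e f :
  e \in E -> f \in E -> e != f -> e \notin S -> f \notin S ->
  cover_sign K es S (e |: S) * cover_sign K es (e |: S) (f |: (e |: S)) =
  - (cover_sign K es S (f |: S) * cover_sign K es (f |: S) (e |: (f |: S))).
Proof.
move=> Ee Ef neq_ef nSe nSf.
have nfe : f \notin e |: S by rewrite !inE negb_or eq_sym neq_ef.
have nef : e \notin f |: S by rewrite !inE negb_or neq_ef.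
rewrite (cover_sign_setU1 nSe) (cover_sign_setU1 nSf).
rewrite (cover_sign_setU1 nfe) (cover_sign_setU1 nef).
rewrite (card_edges_before_setU1 _ nSe) (card_edges_before_setU1 _ nSf).
have -> : (index f es < index e es)%N = ~~ (index e es < index f es)%N.
  rewrite -leqNgt ltn_neqAle andbC; case: leqP => //= _.
  by apply: contraNneq neq_ef => /(index_edge_inj enumE)->.
rewrite 2!exprD; case: (_ < _)%N; rewrite /= expr1 expr0 mul1r mulN1r mulrN.
  by rewrite mulrC.
by rewrite opprK mulrC.
Qed.

Lemma edge_sets_setU1 (i : int) S e :
  S \in edge_sets E i -> e \in E -> e \notin S -> e |: S \in edge_sets E (i + 1).
Proof.
rewrite !inE => /andP[sSE /eqP<-] Ee nSe; rewrite subUset sub1set Ee sSE /=.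
by rewrite cardsU1 nSe PoszD addrC.
Qed.

Lemma edge_sets_setD1 (i : int) S e :
  S \in edge_sets E i -> e \in S -> S :\ e \in edge_sets E (i - 1).
Proof.
rewrite !inE => /andP[sSE /eqP<-] Se; rewrite (subset_trans (subD1set _ _) sSE) /=.
by rewrite (cardsD1 e S) Se PoszD addrC addKr.
Qed.

Definition diff_block S T j :
    'M[K]_(rdegree (M_gmod K (components S) j), rdegree (M_gmod K (components T) j)) :=
  if covers S T then cover_sign K es S T *: F S T j else 0.

Lemma diff_block_comp (i j : int) S U :
  S \in edge_sets E (i - 1) -> U \in edge_sets E (i + 1) ->
  \sum_(T in edge_sets E i) diff_block S T j *m diff_block T U j = 0.
Proof.
move=> S_in; rewrite inE => /andP[sUE _].
(* By functoriality every term is a multiple of [F S U j], so only a sum of signs has to vanish. *)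
transitivity (\sum_(T in edge_sets E i)
  (if covers S T && covers T U
   then cover_sign K es S T * cover_sign K es T U else 0) *: F S U j).
  apply: eq_bigr => T _; rewrite /diff_block.
  have [/coversP[e nSe def_T]|_] := boolP (covers S T); last first.
    by rewrite mul0mx scale0r.
  have [/coversP[f nTf def_U]|_] := boolP (covers T U); last first.
    by rewrite mulmx0 scale0r.
  rewrite -scalemxAl -scalemxAr scalerA; congr (_ *: _); apply/esym.
  by apply: cs_map_comp; rewrite // ?def_U ?def_T subsetUr.
rewrite -scaler_suml; set c0 := \sum_(_ in _) _; suff -> : c0 = 0 by rewrite scale0r.
have [/existsP[T0 /andP[]]|] :=
    boolP [exists T, covers S T && covers T U]; last first.
  move/existsPn=> nST; apply: big1 => T _.
  by rewrite (negPf (nST T)).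
case/coversP=> e nSe -> {T0} /coversP[f nef def_U].
move: (nef); rewrite !inE negb_or => /andP[neq_fe nSf].
have [Ee Ef] : e \in E /\ f \in E.
  by split; apply: (subsetP sUE); rewrite def_U !inE eqxx ?orbT.
have nfe : e \notin f |: S by rewrite !inE negb_or eq_sym neq_fe.
have in_i g : g \in E -> g \notin S -> g |: S \in edge_sets E i.
  by move=> Eg nSg; rewrite -(subrK 1 i) edge_sets_setU1.
(* The only sets strictly between [S] and [U] are [e |: S] and [f |: S]. *)
rewrite /c0 (bigD1 (e |: S)) ?in_i //= (bigD1 (f |: S)) /=; last first.
  rewrite in_i //=; apply: contraNneq nfe => ->; exact: setU11.
rewrite big1 => [|T]; last first.
  case: ifP => // /andP[/coversP[g nSg ->{T}] /coversP[h _ def_U']].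
  have : g \in U by rewrite def_U' !inE eqxx orbT.
  by rewrite def_U !inE (negPf nSg) orbF => /orP[]/eqP->; rewrite eqxx ?andbF.
have covU g T : g \notin T -> covers T (g |: T) by move=> ?; apply/coversP; exists g.
rewrite (covU _ _ nSe) (covU _ _ nSf) {1}def_U (covU _ _ nef).
rewrite {2}def_U setUCA (covU _ _ nfe) addr0 {1}def_U def_U.
by rewrite cover_sign_swap 1?eq_sym // setUCA addNr.
Qed.

Lemma diff_mx_comp (i j : int) :
  diff_mx es F (i - 1) i j *m diff_mx es F i (i + 1) j = 0.
Proof.
rewrite /diff_mx mul_mxblock; apply/mxblockP=> a c; rewrite mxblockK submxblock0.
have := diff_block_comp j (enum_valP a) (enum_valP c).
by rewrite big_enum_val.
Qed.

End Differential.

(** * Exactness in homological degrees at least [#|V|] *)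

Section Exactness.

Variables (K : fieldType) (V : finType) (E : {set {set V}}).
Implicit Types (S T U : {set {set V}}) (e f : {set V}).
Variables (es : seq {set V}) (F : chromatic_functor K E).
Hypothesis graphE : is_graph E.
Hypothesis enumE : perm_eq es (enum E).

Lemma gid_of_eq_unit (P Q : {set {set V}}) (eqPQ : P = Q) j :
  row_free (gid_of_eq K eqPQ j) && row_full (gid_of_eq K eqPQ j).
Proof. by case: Q / eqPQ; rewrite /row_free /row_full mxrank1 eqxx. Qed.

(** Since [e] completes a cycle, the block is a sign times the identity transported along an
    equality of partitions. *)
Lemma diff_block_unit S e j :
  S \subset E -> e \in E -> e \notin S -> spanned S e ->
  row_free (diff_block es F S (e |: S) j) &&
  row_full (diff_block es F S (e |: S) j).
Proof.
move=> sSE Ee nSe spSe; rewrite /diff_block.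
have -> : covers S (e |: S) by apply/coversP; exists e.
rewrite /row_free /row_full !eqmx_scale; last by rewrite expf_neq0 ?oppr_eq0 ?oner_eq0.
have cyc := spanned_completes_cycle (card_graph_edge graphE Ee) nSe spSe.
by have [eqc ->] := cs_map_cycle F sSE Ee nSe cyc; apply: gid_of_eq_unit.
Qed.

(* If [pivot T |: T] covers [S] and [S <> T], then [S] contains [pivot T], so its *)
(* own pivot, which it does not contain, comes strictly later.                  *)
Lemma diff_block_eq0 S T j :
  has (broken es S) es -> has (broken es T) es -> pivot es S \notin S ->
  pivot es T \notin T -> S != T ->
  (find (broken es S) es <= find (broken es T) es)%N ->
  diff_block es F S (pivot es T |: T) j = 0.
Proof.
move=> brS brT nS nT neqST le_ST; rewrite /diff_block; case: ifP => // covST.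
have sST : S \subset pivot es T |: T by case/andP: covST.
have eq_find : find (broken es S) es = find (broken es T) es.
  apply/eqP; rewrite eqn_leq le_ST -(find_broken_addU1 enumE brT).
  exact/sub_find/brokenS.
have eq_piv : pivot es S = pivot es T by rewrite /pivot eq_find.
case/coversP: covST => e nSe def_ST; case/eqP: neqST.
have eq_e : pivot es S = e.
  have : pivot es S \in pivot es T |: T by rewrite eq_piv setU11.
  by rewrite def_ST !inE (negPf nS) orbF => /eqP.
by rewrite -(setU1K nSe) -def_ST -eq_e eq_piv setU1K.
Qed.

(** This is [diff_block_eq0] for the two sets with their pivots deleted, which keeps the pivots. *)
Lemma diff_block_setD1_eq0 S T j :
  has (broken es S) es -> has (broken es T) es -> pivot es S \in S ->
  pivot es T \in T -> T != S ->
  (find (broken es S) es <= find (broken es T) es)%N ->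
  diff_block es F (S :\ pivot es S) T j = 0.
Proof.
move=> brS brT pS pT neqTS le_ST; set S' := S :\ _; pose T' := T :\ pivot es T.
have pivS' : pivot es S' = pivot es S by apply: pivot_setD1.
have pivT' : pivot es T' = pivot es T by apply: pivot_setD1.
have findS' : find (broken es S') es = find (broken es S) es.
  exact: find_broken_setD1.
have findT' : find (broken es T') es = find (broken es T) es.
  exact: find_broken_setD1.
have -> : T = pivot es T' |: T' by rewrite pivT' setD1K.
apply: diff_block_eq0; rewrite ?has_find ?findS' ?findT' -?has_find //.
- by rewrite pivS' setD11.
- by rewrite pivT' setD11.
apply: contraNneq neqTS => eqST'; apply/eqP.
by rewrite -(setD1K pT) -(setD1K pS) -/S' -/T' -pivS' -pivT' eqST'.
Qed.

Lemma diff_block_pivot_free S j :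
  S \subset E -> has (broken es S) es -> pivot es S \notin S ->
  row_free (diff_block es F S (pivot es S |: S) j).
Proof.
move=> sSE brS nS; have Ee := pivot_in enumE brS.
have spS := spannedS (subD1set _ _) (spanned_pivot brS).
by have /andP[] := diff_block_unit j sSE Ee nS spS.
Qed.

Lemma diff_block_pivot_full S j :
  S \subset E -> has (broken es S) es -> pivot es S \in S ->
  row_full (diff_block es F (S :\ pivot es S) S j).
Proof.
move=> sSE brS pS; have Ee := pivot_in enumE brS.
have sDE := subset_trans (subD1set S (pivot es S)) sSE.
have nD : pivot es S \notin S :\ pivot es S by rewrite setD11.
have /andP[_] := diff_block_unit j sDE Ee nD (spanned_pivot brS).
by rewrite setD1K.
Qed.

Hypothesis connE : connected_graph E.

Lemma card_vertices_gt0 : (0 < #|V|)%N.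
Proof.
have /cards1P[B /setP/(_ B)] := connE; rewrite set11 => /imsetP[x _ _].
by apply/card_gt0P; exists x.
Qed.

(** Otherwise [card_components_le] would leave no component, although [V] has a vertex. *)
Lemma has_broken S : S \subset E -> (#|V| <= #|S|)%N -> has (broken es S) es.
Proof.
move=> sSE le_VS; apply: contraLR le_VS => /(card_components_le graphE enumE sSE).
rewrite -ltnNge; apply: leq_trans; rewrite -[ltnLHS]add0n ltn_add2r card_gt0.
have /card_gt0P[x _] := card_vertices_gt0.
apply/set0Pn; exists [set y | connect (adj S) x y].
apply/imsetP; exists x => //; by apply/setP=> y; rewrite !inE.
Qed.

Lemma cocycles_sub_coboundaries (i j : int) :
  #|V|%:Z <= i -> (cocycles es F i j <= coboundaries es F i j)%MS.
Proof.
move=> le_Vi; rewrite genmxE.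
have S_P (b : 'I_#|edge_sets E i|) :
    enum_val b \subset E /\ has (broken es (enum_val b)) es.
  have := enum_valP b; rewrite inE => /andP[sSE /eqP cardS]; split=> //.
  by apply: has_broken => //; rewrite -lez_nat cardS.
(* Sets containing their pivot are matched with degree [i - 1], the others with degree [i + 1]; [r]
   is the position of the pivot. *)
pose A (b : 'I_#|edge_sets E i|) := pivot es (enum_val b) \in enum_val b.
pose r (b : 'I_#|edge_sets E i|) := find (broken es (enum_val b)) es.
apply: (@matching_exact _ _ _ _ _ _ _ _ _ A r); first exact: diff_mx_comp.
  move=> b bP; have [sSE brS] := S_P b.
  have D_in := edge_sets_setD1 (enum_valP b) bP.
  have [a def_a] : exists a : 'I_#|edge_sets E (i - 1)|,
      enum_val a = enum_val b :\ pivot es (enum_val b).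
    exists (enum_rank_in D_in (enum_val b :\ pivot es (enum_val b))).
    exact: enum_rankK_in.
  exists a.
    by have := diff_block_pivot_full j sSE brS bP; rewrite -def_a.
  move=> b' b'P neq_b le_b; have [_ brS'] := S_P b'.
  have neqS : enum_val b' != enum_val b by rewrite (inj_eq enum_val_inj).
  have := diff_block_setD1_eq0 j brS brS' bP b'P neqS le_b.
  by rewrite -def_a.
move=> b nb; have [sSE brS] := S_P b.
have U_in := edge_sets_setU1 (enum_valP b) (pivot_in enumE brS) nb.
have [c def_c] : exists c : 'I_#|edge_sets E (i + 1)|,
    enum_val c = pivot es (enum_val b) |: enum_val b.
  exists (enum_rank_in U_in (pivot es (enum_val b) |: enum_val b)).
  exact: enum_rankK_in.
exists c; first by have := diff_block_pivot_free j sSE brS nb; rewrite -def_c.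
move=> b' nb' neq_b le_b; have [_ brS'] := S_P b'.
have neqS : enum_val b' != enum_val b by rewrite (inj_eq enum_val_inj).
have := diff_block_eq0 j brS' brS nb' nb neqS le_b.
by rewrite -def_c.
Qed.

End Exactness.

Theorem corollary6p6 (R : realType) (V : finType) (E : {set {set V}})
    (es : seq {set V}) (F : chromatic_functor R[i] E) :
  is_graph E -> connected_graph E -> perm_eq es (enum E) ->
  forall i j : int,
    ~~ ((0 <= i <= #|V|%:Z - 1) && (0 <= j <= i)) ->
    rdegree (chromatic_homology es F i j) = 0%N.
Proof.
move=> graphE connE enumE i j out_ij.
suff sZB : (cocycles es F i j <= coboundaries es F i j)%MS.
  apply/eqP; rewrite /= mxrank_gen -(eqn_add2r (\rank (coboundaries es F i j))).
  by rewrite add0n mxrank_in_factmod (addsmx_idPl sZB).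
have [le_Vi|lt_iV] := lerP #|V|%:Z i; first exact: cocycles_sub_coboundaries.
(* Below degree [#|V|] the whole cochain module in bidegree [(i, j)] is zero; for negative [i] there
   is no edge set at all. *)
suff C0 : \rank (cocycles es F i j) = 0%N.
  by move/eqP: C0; rewrite mxrank_eq0 => /eqP->; apply: sub0mx.
apply/eqP; rewrite -leqn0; apply: leq_trans (rank_leq_col _) _.
rewrite leqn0 sum_nat_eq0; apply/forall_inP=> a _; apply/eqP.
rewrite /cochain_size; have := enum_valP a; move: (enum_val a) => T.
rewrite inE => /andP[sTE /eqP cardT].
apply: rdegree_M_gmod (components_partition T) _; apply: contra out_ij.
have := card_components_ge graphE sTE; lia.
Qed.
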